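(* Let $A_L, A_R \in \mathbb{R}^{n \times n}$ be matrices that differ only in their first columns, let $b \in \mathbb{R}^n$, and let $f : \mathbb{R}^n \to \mathbb{R}^n$ be the continuous piecewise-linear map $$f(x) = \begin{cases} A_L x + b, & x_1 \le 0, \\ A_R x + b, & x_1 \ge 0. \end{cases}$$ Suppose $\det(A_L)\det(A_R) > 0$, $\det(I - A_L) \ne 0$, $\det(I - A_R) \ne 0$, and $\varrho^{\mathsf{T}} b \ne 0$, where $\varrho^{\mathsf{T}}$ is the first row of the adjugate matrix $\mathrm{adj}(I - A_L)$. If $f$ has a stable invariant circle $C$, then the restriction $f|_C$ is a degree-$1$ homeomorphism.
   Context: Here $x = (x_1,\ldots,x_n)$ and $I$ is the $n \times n$ identity matrix. ''Differ only in their first columns'' means that all columns other than the first coincide. An invariant circle of $f$ is a simple closed curve $C \subset \mathbb{R}^n$ with $f(C) = C$. It is stable if it is Lyapunov stable: for every neighbourhood $U$ of $C$ there exists a neighbourhood $V$ of $C$ such that $f^i(x) \in U$ for all $x \in V$ and all $i \ge 0$. Represent $\mathbb{S}^1$ by $[0,1)$ with $1$ identified with $0$, and let $\pi(w) = w - \lfloor w \rfloor$. A lift of a continuous map $g : \mathbb{S}^1 \to \mathbb{S}^1$ is a continuous $G : \mathbb{R} \to \mathbb{R}$ with $\pi(G(w)) = g(\pi(w))$ for all $w \in \mathbb{R}$. The degree of $g$ is the integer $G(1) - G(0)$, which is independent of the lift. The degree of $f|_C$ is the degree of $\varphi \circ f|_C \circ \varphi^{-1}$ for any homeomorphism $\varphi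 : C \to \mathbb{S}^1$ (it does not depend on $\varphi$). *)

(* Defs.v *)
From HB Require Import structures.
From mathcomp Require Import all_boot all_order all_algebra.
From mathcomp Require Import all_classical all_reals all_analysis.

Set Implicit Arguments.
Unset Strict Implicit.
Unset Printing Implicit Defensive.

Import Order.TTheory GRing.Theory Num.Theory.
Import numFieldNormedType.Exports.

Local Open Scope classical_set_scope.
Local Open Scope ring_scope.

Definition pwl_map (R : realType) (n : nat) (AL AR : 'M[R]_n.+1)
    (b x : 'cV[R]_n.+1) : 'cV[R]_n.+1 :=
  if x ord0 ord0 <= 0 then AL *m x + b else AR *m x + b.

(* The two branches agree on x_1 = 0, so the choice made there by [pwl_map]
   is immaterial. *)
Lemma pwl_map_ge0 (R : realType) (n : nat) (AL AR : 'M[R]_n.+1)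
    (b x : 'cV[R]_n.+1) :
  (forall j : 'I_n.+1, j != ord0 -> col j AL = col j AR) ->
  0 <= x ord0 ord0 -> pwl_map AL AR b x = AR *m x + b.
Proof.
move=> AE x_ge0; rewrite /pwl_map; case: ifPn => // x_le0; congr (_ + _).
have x0 : x ord0 ord0 = 0 by apply/eqP; rewrite eq_le x_le0.
apply/matrixP => i k; rewrite !mxE; apply: eq_bigr => j _.
have [->|/AE/matrixP/(_ i ord0)] := eqVneq j ord0; last by rewrite !mxE => ->.
by rewrite (ord1 k) x0 !mulr0.
Qed.

Definition frac_set (R : realType) : Type := {w : R | 0 <= w < 1}.

Lemma frac_subproof (R : realType) (w : R) :
  0 <= w - (Num.floor w)%:~R < 1.
Proof.
have /andP[fw wf] := floor_itv w.
by rewrite subr_ge0 fw ltrBlDl -[X in _ + X]/(1%:~R) -intrD.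
Qed.

Definition frac_pi (R : realType) (w : R) : frac_set R :=
  exist _ (w - (Num.floor w)%:~R) (frac_subproof w).

Lemma frac_piK (R : realType) : cancel (@sval R _) (@frac_pi R).
Proof.
move=> [w w01]; apply: val_inj => /=.
by rewrite (@floor_def _ w 0) ?subr0// add0r.
Qed.

HB.instance Definition _ (R : realType) :=
  isQuotient.Build R (frac_set R) (@frac_piK R).

(* The circle is [0, 1) with the quotient topology of [frac_pi : R -> [0, 1)],
   which glues 1 to 0. *)
Definition circle (R : realType) : topologicalType :=
  quotient_topology (frac_set R).

Definition circle_pi (R : realType) (w : R) : circle R := frac_pi w.

(* [f] restricts to a homeomorphism from A onto B (for the subspace
   topologies) whose inverse is the restriction of [g]. *)
Definition homeo_with (T U : topologicalType) (A : set T) (B : set U)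
    (f : T -> U) (g : U -> T) : Prop :=
  [/\ {homo f : x / A x >-> B x}, {homo g : y / B y >-> A y},
      {within A, continuous f}, {within B, continuous g} &
      (forall x, A x -> g (f x) = x) /\ (forall y, B y -> f (g y) = y)].

Definition homeo_on (T U : topologicalType) (A : set T) (B : set U)
    (f : T -> U) : Prop :=
  exists g : U -> T, homeo_with A B f g.

Definition simple_closed_curve (R : realType) (T : topologicalType)
    (C : set T) : Prop :=
  exists phi : T -> circle R, homeo_on C setT phi.

Definition invariant_circle (R : realType) (n : nat)
    (f : 'cV[R]_n.+1 -> 'cV[R]_n.+1) (C : set 'cV[R]_n.+1) : Prop :=
  simple_closed_curve R C /\ f @` C = C.

Definition lyapunov_stable (T : topologicalType) (f : T -> T)
    (C : set T) : Prop :=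
  forall U : set T, set_nbhs C U ->
    exists2 V : set T, set_nbhs C V &
      forall x, V x -> forall i : nat, U (iter i f x).

Definition is_lift (R : realType) (g : circle R -> circle R) (G : R -> R) :
    Prop :=
  continuous G /\ forall w, circle_pi (G w) = g (circle_pi w).

Definition has_degree (R : realType) (g : circle R -> circle R) (d : int) :
    Prop :=
  exists2 G : R -> R, is_lift g G & G 1 - G 0 = d%:~R.

(* Meaningful when C is a simple closed curve mapped into itself by f; the
   degree is then the same for every parametrization [phi] of C, with
   inverse [psi]. *)
Definition has_degree_on (R : realType) (T : topologicalType) (C : set T)
    (f : T -> T) (d : int) : Prop :=
  forall (phi : T -> circle R) (psi : circle R -> T),
    homeo_with C setT phi psi -> has_degree (phi \o f \o psi) d.

(* Main.v *)
(** Since [det AL] and [det AR] have the same sign, [f] is a homeomorphism of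
    the whole space, so [f] restricts to a homeomorphism of [C], whose lift is
    monotone: the degree is 1 or -1.  In degree -1 the lift is decreasing, so
    [f] has two distinct fixed points on [C].  A fixed point [x] of the branch
    [A] satisfies [det (I - A) x_1 = rho b != 0], and each half-space contains
    at most one, so [det (I - AL)] and [det (I - AR)] have opposite signs.  For
    the branch with the negative one, [A] has an eigenvalue [l > 1], say with
    eigenvector [v], and a fixed point [z].  Stability forces the local
    unstable ray [z + s v] into [C], because each of its points is reached
    from points arbitrarily close to [z].  But [f] acts on this ray by
    [s |-> l s], staying on the same side of [z], which a decreasing lift
    forbids. *)

Require Import Defs.
From mathcomp Require Import all_boot all_order all_algebra.
From mathcomp Require Import all_classical all_reals all_analysis.
From mathcomp Require Import zify ring lra.
From mathcomp Require polyrcf.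
Import Order.TTheory GRing.Theory Num.Theory.
Import numFieldNormedType.Exports.
Local Open Scope classical_set_scope.
Local Open Scope ring_scope.

Set Implicit Arguments.
Unset Strict Implicit.

(** * Piecewise-linear maps *)

(** These entries are the cofactors along the first column, and their minors delete that column. *)
Lemma adj_row0_eq (K : comNzRingType) (n : nat) (A B : 'M[K]_n.+1)
    (ABcol : forall j : 'I_n.+1, j != ord0 -> col j A = col j B) :
  row ord0 (\adj A) = row ord0 (\adj B).
Proof.
apply/rowP => i; rewrite !mxE /cofactor; congr (_ * \det _).
apply/matrixP => k l; rewrite !mxE.
have /ABcol/colP/(_ (lift i k)) : lift ord0 l != ord0.
  by rewrite eq_sym neq_lift.
by rewrite !mxE.
Qed.

Lemma adj_row0_mul (K : comNzRingType) (n : nat) (A B : 'M[K]_n.+1)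
    (x : 'cV[K]_n.+1)
    (ABcol : forall j : 'I_n.+1, j != ord0 -> col j A = col j B) :
  row ord0 (\adj A) *m (B *m x) = (\det B * x ord0 ord0)%:M.
Proof.
rewrite (adj_row0_eq ABcol) mulmxA -row_mul mul_adj_mx; apply/rowP => i.
by rewrite (ord1 i) -row_mul mul_scalar_mx !mxE eqxx mulr1n.
Qed.

(** The characteristic polynomial is monic and negative at 1, so it has a root beyond 1. *)
Lemma det1B_lt0_eigenvalue (K : rcfType) (n : nat) (A : 'M[K]_n) :
  \det (1%:M - A) < 0 ->
  exists2 l : K, 1 < l & exists2 v : 'cV[K]_n, v != 0 & A *m v = l *: v.
Proof.
move=> dA.
have pE (x : K) : (char_poly A).[x] = \det (x%:M - A).
  rewrite /char_poly -horner_evalE -det_map_mx; congr (\det _).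
  by apply/matrixP => i j; rewrite !mxE /= horner_evalE !(hornerE, hornerMn).
have [M Mp] : exists M, forall x, x >= M -> (char_poly A).[x] >= 1.
  have /eqP lc := char_poly_monic A.
  have [|M MP] := @polyrcf.poly_pinfty_gt_lc _ (char_poly A).
    by rewrite lc.
  by exists M => x /MP; rewrite lc.
have [||l] := @Num.Theory.poly_ivt _ (char_poly A) 1 (Num.max 1 M).
- by rewrite le_max lexx.
- rewrite pE (ltW dA) (le_trans ler01) // Mp //.
  by rewrite le_max lexx orbT.
case/andP => l1 _ rl.
have l_gt1 : 1 < l.
  rewrite lt_neqAle l1 andbT; apply: contraTneq dA => l1'.
  by rewrite -pE l1' (rootP rl) ltxx.
exists l => //.
(* [det0P] yields a row vector in the left kernel; transposing first turns it into a right
   eigenvector of [A]. *)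
move: rl; rewrite rootE pE -det_tr => /det0P[v v0 vA].
exists v^T; first by rewrite trmx_eq0.
apply/eqP; rewrite eq_sym -subr_eq0 -mul_scalar_mx -mulmxBl -trmx_eq0.
by rewrite trmx_mul trmxK vA.
Qed.

Lemma continuous_mulmx (K : numFieldType) (m n : nat) (A : 'M[K]_(m, n)) :
  continuous (fun x : 'cV[K]_n => A *m x).
Proof.
have -> : (fun x : 'cV[K]_n => A *m x) = fun x => \sum_j x j ord0 *: col j A.
  apply/funext => x; apply/colP => i; rewrite !mxE summxE.
  by apply: eq_bigr => j _; rewrite !mxE mulrC.
have term j : continuous (fun x : 'cV[K]_n => x j ord0 *: col j A).
  by move=> x; exact: (cvgZr_tmp (@coord_continuous K _ _ j ord0 x)).
apply: continuous_big => [|j _]; [exact: add_continuous|exact: term].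
Qed.

Lemma continuous_coord_min0 (R : realType) (n : nat) (i : 'I_n) :
  continuous (fun x : 'cV[R]_n => Num.min (x i ord0) 0).
Proof.
move=> x; have xi := @coord_continuous R _ _ i ord0 x.
by have := continuous_min xi (@cst_continuous _ R^o 0 x).
Qed.

Section pwl.
Variables (R : realType) (n : nat) (AL AR : 'M[R]_n.+1) (b : 'cV[R]_n.+1).
Hypothesis (Acol : forall j : 'I_n.+1, j != ord0 -> col j AL = col j AR).
Local Notation f := (pwl_map AL AR b).

(** [AL - AR] vanishes outside its first column, so the branches differ by a multiple of that
    column. Without a case split, continuity is immediate and inversion becomes a scalar problem. *)
Lemma pwl_mapE x :
  f x = AR *m x + b + Num.min (x ord0 ord0) 0 *: col ord0 (AL - AR).
Proof.
case: (leP (x ord0 ord0) 0) => [x0|/ltW x0]; last first.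
  by rewrite scale0r addr0 pwl_map_ge0.
rewrite /pwl_map x0 addrAC; congr (_ + _).
apply/eqP; rewrite -subr_eq0 opprD addrA -mulmxBl subr_eq0; apply/eqP.
apply/colP => i; rewrite !mxE (bigD1 ord0) //= big1 ?addr0 => [|j j0].
  by rewrite !mxE mulrC.
by have /colP/(_ i) := Acol j0; rewrite !mxE => ->; rewrite subrr mul0r.
Qed.

Hypothesis detA : 0 < \det AL * \det AR.

(** The direction of the kink, pulled back by [AR]: [invmx AR *m (f x - b)] is
    [x + min(x_1, 0) w]. *)
Let w := invmx AR *m col ord0 (AL - AR).

Let AR_unit : AR \in unitmx.
Proof.
by rewrite unitmxE unitfE; apply: contraTneq detA => ->; rewrite mulr0 ltxx.
Qed.

(* [AL] is a rank-one perturbation of [AR], so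
   [\det AL = \det AR * (1 + w ord0 ord0)]. *)
Lemma pwl_slope_gt0 : 0 < 1 + w ord0 ord0.
Proof.
have dR : \det AR != 0 by rewrite -unitfE -unitmxE.
suff -> : 1 + w ord0 ord0 = (\det AL * \det AR) / (\det AR) ^+ 2.
  by rewrite divr_gt0 // exprn_even_gt0.
apply: (mulfI dR); rewrite mulrDr mulr1.
have -> : \det AR * w ord0 ord0 = \det AL - \det AR.
  rewrite /w /invmx AR_unit -scalemxAl mxE mulVKf //.
  (* Cofactor expansion of [\det B] along its first column, with the cofactors taken from [AR]. *)
  have detE (B : 'M[R]_n.+1) :
      (forall j : 'I_n.+1, j != ord0 -> col j AR = col j B) ->
      (\adj AR *m col ord0 B) ord0 ord0 = \det B.
    move=> h; have /rowP/(_ ord0) := adj_row0_mul (delta_mx ord0 ord0) h.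
    by rewrite -row_mul -colE !mxE !eqxx mulr1 mulr1n.
  rewrite linearB /= mulmxBr [LHS]mxE [X in _ + X]mxE.
  by rewrite !detE // => j /Acol.
by field.
Qed.

(** With [z = x + min(x_1, 0) w], the coordinate [z_1] is [x_1] or [(1 + w_1) x_1] according to the
    side. The slope [1 + w_1] is positive, so [min(z_1, 0) / (1 + w_1)] recovers [min(x_1, 0)]. *)
Definition pwl_inv (y : 'cV[R]_n.+1) : 'cV[R]_n.+1 :=
  let z := invmx AR *m (y - b) in
  z - (Num.min (z ord0 ord0) 0 / (1 + w ord0 ord0)) *: w.

Lemma pwl_mapK : cancel f pwl_inv.
Proof.
move=> x; rewrite /pwl_inv.
have -> : invmx AR *m (f x - b) = x + Num.min (x ord0 ord0) 0 *: w.
  by rewrite pwl_mapE addrAC addrK mulmxDr mulKmx // scalemxAr.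
have := pwl_slope_gt0; move: w => u; rewrite !mxE.
set x0 := x _ _; set k := u _ _ => k0.
suff -> : Num.min (x0 + Num.min x0 0 * k) 0 = Num.min x0 0 * (1 + k).
  by rewrite mulfK ?gt_eqF// addrK.
case: (leP x0 0) => h; last by rewrite !mul0r addr0 min_r// ltW.
by rewrite mulrDr mulr1 min_l // -[X in X + _]mulr1 -mulrDr mulr_le0_ge0 // ltW.
Qed.

Lemma continuous_pwl_map : continuous f.
Proof.
have -> : f = fun x =>
    AR *m x + b + Num.min (x ord0 ord0) 0 *: col ord0 (AL - AR).
  by apply/funext => x; exact: pwl_mapE.
move=> x; exact: (cvgD
  (cvgD (@continuous_mulmx _ _ _ AR x) (@cst_continuous _ _ b x))
  (cvgZr_tmp (@continuous_coord_min0 _ _ ord0 x))).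
Qed.

Lemma continuous_pwl_inv : continuous pwl_inv.
Proof.
have zc : continuous (fun y : 'cV[R]_n.+1 => invmx AR *m (y - b)).
  move=> y; under eq_fun do rewrite mulmxBr.
  have cy := @continuous_mulmx _ _ _ (invmx AR) y.
  exact: (cvgB cy (@cst_continuous _ _ _ y)).
move=> y.
have minc := @continuous_coord_min0 R n.+1 ord0 (invmx AR *m (y - b)).
have mc := @continuous_comp _ _ _ _ _ y (zc y) minc.
exact: (cvgB (zc y) (cvgZr_tmp (cvgMr_tmp mc))).
Qed.

Lemma pwl_map_same_side (x z : 'cV[R]_n.+1) :
  0 < x ord0 ord0 * z ord0 ord0 ->
  f x = (if z ord0 ord0 <= 0 then AL else AR) *m x + b.
Proof.
case: (leP (z ord0 ord0) 0) => z0 xz.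
  rewrite /pwl_map ifT // leNgt; apply: contraTN xz => x0.
  by rewrite -leNgt mulr_ge0_le0 // ltW.
by rewrite pwl_map_ge0 // ltW // -(pmulr_lgt0 _ z0).
Qed.

Lemma pwl_map_eigenray (z v : 'cV[R]_n.+1) (l : R) :
  z ord0 ord0 != 0 -> f z = z ->
  (if z ord0 ord0 <= 0 then AL else AR) *m v = l *: v ->
  exists2 s0 : R, 0 < s0 &
    forall s, 0 <= s <= s0 -> f (z + s *: v) = z + (l * s) *: v.
Proof.
set A := (if _ then _ else _) => z0 fz Av.
set a := z ord0 ord0 in z0; set d := v ord0 ord0.
have a0 : 0 < `|a| by rewrite normr_gt0.
have d0 : 0 < 1 + `|d| by rewrite ltr_wpDr.
(* This bound keeps the first coordinate within [|a| / 2] of [a], hence on the side of [z]; the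
   summand 1 covers [d = 0]. *)
exists (`|a| / 2 / (1 + `|d|)); first by rewrite !divr_gt0.
move=> s /andP[s_ge0 s_le].
rewrite (@pwl_map_same_side _ z) -/A.
  rewrite mulmxDr addrAC -scalemxAr Av scalerA [s * l]mulrC; congr (_ + _).
  by rewrite -[RHS]fz (@pwl_map_same_side z z) // -expr2 exprn_even_gt0.
rewrite !mxE -/a -/d.
have sd : `|s * d| <= `|a| / 2.
  rewrite normrM ger0_norm // (le_trans (ler_wpM2r _ s_le)) //.
  rewrite mulrAC -mulrA ler_piMr ?divr_ge0 //.
  by rewrite -/(_ / _) ler_pdivrMr // mul1r lerDr.
have : - (s * d * a) <= `|a| / 2 * `|a|.
  by rewrite (le_trans (ler_norm _)) // normrN normrM ler_wpM2r.
rewrite mulrDl -expr2 -[a ^+ 2]real_normK ?num_real//.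
by nra.
Qed.

Hypothesis detIL : \det (1%:M - AL) != 0.
Hypothesis detIR : \det (1%:M - AR) != 0.
Hypothesis rho_b : row ord0 (\adj (1%:M - AL)) *m b != 0.

Let side (x : 'cV[R]_n.+1) := if x ord0 ord0 <= 0 then AL else AR.

Let fixed_eq x : f x = x -> (1%:M - side x) *m x = b.
Proof.
move=> fx; rewrite mulmxBl mul1mx -{1}fx /side /pwl_map.
case: ifPn => [_|]; first by rewrite addrAC subrr add0r.
by rewrite -ltNge => /ltW x0; rewrite addrAC subrr add0r.
Qed.

(** Multiply the fixed point equation by the first adjugate row, which is the same for both
    branches. The left side does not depend on [x], so two fixed points can be compared. *)
Let fixed_det x : f x = x ->
  row ord0 (\adj (1%:M - AL)) *m b = (\det (1%:M - side x) * x ord0 ord0)%:M.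
Proof.
move=> fx; rewrite -{1}(fixed_eq fx); apply: adj_row0_mul => j /Acol /colP jE.
apply/colP => i; have := jE i; rewrite /side.
by case: ifP; rewrite !mxE => // _ ->.
Qed.

(** Each branch has at most one fixed point, so [x] and [y] use different branches. Were both
    determinants positive, the common value of [det * x_1] would put both points on the same
    side. *)
Lemma pwl_map_saddle (x y : 'cV[R]_n.+1) : x != y -> f x = x -> f y = y ->
  exists2 z, z = x \/ z = y & exists v l s0,
    [/\ v != 0, 1 < l, 0 < s0 &
      forall s, 0 <= s <= s0 -> f (z + s *: v) = z + (l * s) *: v].
Proof.
move=> xy fx fy.
suff [z zxy dz] : exists2 z, z = x \/ z = y & \det (1%:M - side z) < 0.
  exists z => //; have fz : f z = z by case: zxy => ->.
  have [l l1 [v v0 Av]] := det1B_lt0_eigenvalue dz.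
  have z0 : z ord0 ord0 != 0.
    by apply: contraNneq rho_b => z0; rewrite (fixed_det fz) z0 mulr0 raddf0.
  by have [s0 s00 zs] := pwl_map_eigenray z0 fz Av; exists v, l, s0.
have side_neq : side x != side y.
  apply: contra_neq xy => sxy.
  have u : 1%:M - side x \in unitmx.
    by rewrite unitmxE unitfE /side; case: ifP.
  by rewrite -(mulKmx u x) (fixed_eq fx) sxy -(fixed_eq fy) -sxy mulKmx.
have dxy : \det (1%:M - side x) * x ord0 ord0 =
           \det (1%:M - side y) * y ord0 ord0.
  have := fixed_det fx; rewrite (fixed_det fy) => /matrixP/(_ ord0 ord0).
  by rewrite !mxE !eqxx !mulr1n.
have dn z : \det (1%:M - side z) != 0 by rewrite /side; case: ifP.
have [dx|dx] := ltP (\det (1%:M - side x)) 0; first by exists x; [left|].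
have [dy|dy] := ltP (\det (1%:M - side y)) 0; first by exists y; [right|].
have {dx}dx : 0 < \det (1%:M - side x) by rewrite lt_neqAle eq_sym dn.
have {dy}dy : 0 < \det (1%:M - side y) by rewrite lt_neqAle eq_sym dn.
have sxy : (x ord0 ord0 <= 0) = (y ord0 ord0 <= 0).
  by rewrite -(pmulr_rle0 _ dx) dxy pmulr_rle0.
by move: side_neq; rewrite /side sxy eqxx.
Qed.
End pwl.

(** * The circle and its homeomorphisms *)

Section circle.
Variable R : realType.
Local Notation pi := (@circle_pi R).

Lemma circle_piE : \pi_(frac_set R)%qT = pi.
Proof. by apply/funext => w; rewrite unlock. Qed.

Lemma continuous_circle_pi : continuous pi.
Proof. by rewrite -circle_piE; exact: (@pi_continuous R (frac_set R)). Qed.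

Lemma circle_piDz (w : R) (k : int) : pi (w + k%:~R) = pi w.
Proof.
suff: sval (frac_pi (w + k%:~R)) = sval (frac_pi w).
  by rewrite /circle_pi; exact: val_inj.
rewrite /= floorDrz ?intr_int // intrKfloor intrD.
by rewrite opprD addrACA subrr addr0.
Qed.

Lemma circle_pi_eqP (v w : R) : pi v = pi w -> exists k : int, v = w + k%:~R.
Proof.
move=> /(congr1 (@sval _ _)) /= e; exists (Num.floor v - Num.floor w).
by rewrite intrB addrCA -e [RHS]addrC subrK.
Qed.

(** The section of [circle_pi] with values in [[a, a + 1)]. The cut [a] is a parameter so that it
    can be placed away from the points under study. *)
Definition circle_sec (a : R) (p : circle R) : R :=
  let w := sval (p : frac_set R) in w - (Num.floor (w - a))%:~R.

Lemma circle_secK a : cancel (circle_sec a) pi.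
Proof.
by move=> p; rewrite /circle_sec -intrN circle_piDz; exact: frac_piK.
Qed.

Lemma circle_sec_itv a p : a <= circle_sec a p < a + 1.
Proof.
rewrite /circle_sec; set w := sval _.
have /andP[h1 h2] := floor_itv (w - a); move: h2; rewrite intrD => h2.
by apply/andP; split; lra.
Qed.

Lemma circle_piK a (w : R) : a <= w < a + 1 -> circle_sec a (pi w) = w.
Proof.
move=> aw; have [k e] := circle_pi_eqP (circle_secK a (pi w)).
have := circle_sec_itv a (pi w); rewrite e.
suff -> : k = 0 by rewrite addr0.
have /andP[] := circle_sec_itv a (pi w); rewrite e => h1 h2.
move/andP: aw => [h3 h4].
have k1 : (k%:~R : R) < 1%:~R by rewrite mulr1z; lra.
have k2 : ((-1)%:~R : R) < k%:~R by rewrite mulrN1z; lra.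
by move: k1 k2; rewrite !ltr_int; lia.
Qed.

Lemma circle_sec_inj a : injective (circle_sec a).
Proof. exact: can_inj (@circle_secK a). Qed.

(** The preimage of the image is the union of the integer translates of [A]. *)
Lemma open_circle_pi (A : set R) : open A -> open (pi @` A).
Proof.
move=> oA.
suff : open (pi @^-1` (pi @` A)) by rewrite -{1}circle_piE.
rewrite (_ : _ @^-1` _ = \bigcup_(k in [set: int]) [set w : R | A (w + k%:~R)]).
  apply: bigcup_open => k _.
  apply: (@open_comp _ _ (fun w : R => w + k%:~R)) => // w _.
  by apply: cvgD; [exact: cvg_id|exact: cvg_cst].
apply/seteqP; split=> [w [v Av /circle_pi_eqP[k e]]|w [k _ Aw]].
  by exists k => //=; rewrite -e.
by exists (w + k%:~R) => //; rewrite circle_piDz.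
Qed.

Lemma nbhs_circle_pi (w : R) (A : set R) : nbhs w A -> nbhs (pi w) (pi @` A).
Proof.
rewrite !nbhsE => -[B [oB Bw] BA].
exists (pi @` B); last exact: image_subset.
by split; [exact: open_circle_pi|exists w].
Qed.

(** Off the cut, the section is a local inverse of the open map [circle_pi]. *)
Lemma continuous_circle_sec a p :
  circle_sec a p != a -> {for p, continuous (circle_sec a)}.
Proof.
move=> pa A /= nA.
have /andP[ap pa1] := circle_sec_itv a p.
have nI : nbhs (circle_sec a p) `]a, a + 1[%classic.
  apply: open_nbhs_nbhs; split; first exact: itv_open.
  by rewrite /= in_itv /= pa1 andbT lt_neqAle eq_sym pa.
have nAI : nbhs (circle_sec a p) (A `&` `]a, a + 1[) by exact: filterI.
have := nbhs_circle_pi nAI; rewrite circle_secK.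
suff sub : pi @` (A `&` `]a, a + 1[) `<=` circle_sec a @^-1` A.
  by move=> nP; exact: (filterS sub nP).
move=> q [w [Aw]]; rewrite /= in_itv /= => /andP[aw wa] <-.
by rewrite circle_piK // wa (ltW aw).
Qed.

Definition circle_opp (p : circle R) : circle R := pi (- sval (p : frac_set R)).

Lemma circle_oppE w : circle_opp (pi w) = pi (- w).
Proof.
by rewrite /circle_opp /= opprD opprK circle_piDz.
Qed.

Lemma circle_oppK : involutive circle_opp.
Proof.
by move=> p; rewrite -(circle_secK 0 p) !circle_oppE opprK.
Qed.

Lemma continuous_circle_opp : continuous circle_opp.
Proof.
apply/(@quotient_continuous R (frac_set R)).
have -> : circle_opp \o \pi_(frac_set R)%qT = pi \o -%R.
  rewrite circle_piE.
  by apply/funext => w; exact: circle_oppE.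
move=> w; apply: continuous_comp; first exact: opp_continuous.
exact: continuous_circle_pi.
Qed.

(** For a lift [G], the constant [c] is the degree. *)
Definition period1 (c : R) (G : R -> R) := forall w, G (w + 1) = G w + c.

(** A monotone surjection cannot jump. This gives continuity of a lift without gluing its pieces at
    the integers. *)
Lemma incr_surj_continuous (G : R -> R) :
  {homo G : x y / x < y} -> (forall y, exists x, G x = y) -> continuous G.
Proof.
move=> Glt Gs x; have Gle := le_mono Glt.
have /continuous_within_itvP : {within `[x - 1, x + 1], continuous G}.
  apply: segment_inc_surj_continuous => [u v _ _|y]; first exact: Gle.
  have [v <-] := Gs y.
  rewrite /= in_itv /= !Gle => /andP[h1 h2].
  by exists v => //=; rewrite in_itv /= h1.
have x1 : x - 1 < x + 1 by lra.
by move=> /(_ x1)[+ _ _]; apply; rewrite in_itv /=; apply/andP; split; lra.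
Qed.

(** Read in the chart cut at [g (pi 0)], the map is 1-periodic in [w] and increasing on each unit
    cell; adding [floor w] makes up for its drop at the integers. *)
Lemma circle_incr_lift (g : circle R -> circle R) (a : R) :
  (forall q, exists p, g p = q) -> circle_sec a (g (pi 0)) = a ->
  injective g ->
  {in `]0, 1[ &, {homo (fun w => circle_sec a (g (pi w))) : x y / x < y}} ->
  exists G : R -> R, [/\ continuous G, forall w, pi (G w) = g (pi w),
    {homo G : x y / x < y} & period1 1 G].
Proof.
move=> gs ga gi Hlt; pose H w := circle_sec a (g (pi w)).
pose G w := H w + (Num.floor w)%:~R.
have HDz (w : R) (k : int) : H (w + k%:~R) = H w by rewrite /H circle_piDz.
(* Monotonicity extends to the endpoint 0, where [H] takes the least value [a] of its chart. *)
have H01 : {in `[0, 1[ &, {homo H : x y / x < y}}.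
  move=> x y; rewrite !in_itv /= => /andP[x0 x1] /andP[y0 y1] xy.
  have [x0'|x0'] := eqVneq x 0; last first.
    apply: Hlt => //; rewrite in_itv /= ?x1 ?y1 andbT ?(le_lt_trans x0 xy) //.
    by rewrite lt_neqAle eq_sym x0'.
  have /andP[+ _] := circle_sec_itv a (g (pi y)); rewrite -/(H y).
  rewrite le_eqVlt x0' (ga : H 0 = a) => /orP[/eqP e|//]; exfalso.
  have /circle_sec_inj/gi/(congr1 (circle_sec 0)) : H 0 = H y.
    by rewrite -e; exact: ga.
  rewrite !circle_piK ?lexx ?y0 ?add0r ?ltr01 ?y1 // => y0'.
  by move: xy; rewrite x0' y0' ltxx.
have Hfrac w : H w = H (w - (Num.floor w)%:~R) by rewrite -intrN HDz.
have frac01 (w : R) : w - (Num.floor w)%:~R \in `[0, 1[.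
  by rewrite in_itv; exact: frac_subproof.
(* Within a cell this is [H01]; between cells the floor gains at least 1 while [H] varies by less
   than 1. *)
have Glt : {homo G : x y / x < y}.
  move=> x y xy; rewrite /G.
  have : (Num.floor x <= Num.floor y) by apply: le_floor; exact: ltW.
  rewrite le_eqVlt => /orP[/eqP e|].
    by rewrite e ltrD2r Hfrac (Hfrac y) H01 // e ltrD2r.
  rewrite -lezD1 -(ler_int R) intrD => fxy.
  have /andP[_ h1] := circle_sec_itv a (g (pi x)); rewrite -/(H x) in h1.
  have /andP[h2 _] := circle_sec_itv a (g (pi y)); rewrite -/(H y) in h2.
  by lra.
exists G; split=> //.
- apply: incr_surj_continuous => // y.
  have [p gp] := gs (pi y).
  have [k yk] := circle_pi_eqP (circle_secK a (pi y)).
  pose w := circle_sec 0 p.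
  have fw : Num.floor w = 0.
    apply: floor_def; rewrite add0r mulr0z mulr1z.
    by have := circle_sec_itv 0 p; rewrite add0r.
  exists (w - k%:~R); rewrite /G -intrN HDz floorDrz ?intr_int // fw.
  rewrite add0r intrKfloor /H circle_secK gp yk intrN; lra.
- by move=> w; rewrite /G circle_piDz circle_secK.
- by move=> w; rewrite /G (HDz w 1) floorDrz ?rpred1 // floor1 intrD addrA.
Qed.

(** By injectivity, [g] sends the open cell []0, 1[] off the cut at [g (pi 0)]. There it is a
    continuous injective real function, hence strictly monotone. *)
Lemma circle_lift (g : circle R -> circle R) :
  continuous g -> injective g -> (forall q, exists p, g p = q) ->
  exists G : R -> R, [/\ continuous G, forall w, pi (G w) = g (pi w) &
    ({homo G : x y / x < y} /\ period1 1 G) \/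
    ({homo G : x y /~ x < y} /\ period1 (-1) G)].
Proof.
move=> gc gi gs; pose a := circle_sec 0 (g (pi 0)).
have ga : circle_sec a (g (pi 0)) = a.
  by rewrite -[g _](circle_secK 0) circle_piK // lexx ltrDl ltr01.
pose H w := circle_sec a (g (pi w)).
have pi_inj : {in `]0, 1[ &, injective pi}.
  move=> x y; rewrite !in_itv /= => /andP[x0 x1] /andP[y0 y1].
  move=> /(congr1 (circle_sec 0)).
  by rewrite !circle_piK ?add0r // ltW.
have H_neq (w : R) : w \in `]0, 1[ -> H w != a.
  move=> w01; apply/eqP => Hw; have /circle_sec_inj/gi := etrans Hw (esym ga).
  move: w01; rewrite in_itv /= => /andP[w0 w1] /(congr1 (circle_sec 0)).
  rewrite !circle_piK ?lexx ?(ltW w0) ?add0r ?ltr01 ?w1 // => w0'.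
  by rewrite w0' ltxx in w0.
have Hc : {within [set` `]0, 1[], continuous H}.
  apply: continuous_in_subspaceT => w; rewrite inE /= => /H_neq Hw.
  apply: (@continuous_comp _ _ _ (g \o pi) (circle_sec a)).
    by apply: continuous_comp; [exact: continuous_circle_pi|exact: gc].
  exact: continuous_circle_sec.
have Hi : {in `]0, 1[ &, injective H}.
  by move=> x y x01 y01 /circle_sec_inj/gi; exact: pi_inj.
have [Hlt|Hgt] := itv_continuous_inj_mono Hc Hi.
  have [G [Gc Gg Glt Gp]] := circle_incr_lift gs ga gi Hlt.
  by exists G; split=> //; left.
(* In the decreasing case, the reflection of [g] has an increasing lift. *)
pose g' := circle_opp \o g.
have g's q : exists p, g' p = q.
  by have [p gp] := gs (circle_opp q); exists p; rewrite /g' /= gp circle_oppK.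
have g'a : circle_sec (- a) (g' (pi 0)) = - a.
  rewrite /g' /= -[g _](circle_secK 0) circle_oppE circle_piK //.
  by rewrite lexx ltrDl ltr01.
have g'i : injective g' by move=> x y /(can_inj circle_oppK)/gi.
(* [H w] lies in []a, a + 1[], so [- H w] must be shifted by 1 to land in the chart starting at
   [- a]. *)
have g'H (w : R) : w \in `]0, 1[ -> circle_sec (- a) (g' (pi w)) = 1 - H w.
  move=> w01; rewrite /g' /= -[g _](circle_secK a) circle_oppE -/(H w).
  rewrite -(circle_piDz _ 1) circle_piK; first by rewrite addrC.
  have /andP[] := circle_sec_itv a (g (pi w)); rewrite -/(H w) le_eqVlt.
  rewrite eq_sym (negPf (H_neq _ w01)) /= => h1 h2.
  by apply/andP; split; rewrite mulr1z; lra.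
have g'lt : {in `]0, 1[ &,
    {homo (fun w => circle_sec (- a) (g' (pi w))) : x y / x < y}}.
  move=> x y x01 y01 xy; rewrite !g'H //.
  by rewrite ltrD2l ltrN2; exact: Hgt.
have [G [Gc Gg Glt Gp]] := circle_incr_lift g's g'a g'i g'lt.
exists (fun w => - G w); split.
- by move=> w; apply: cvgN; exact: Gc.
- by move=> w; rewrite -circle_oppE Gg /g' /= circle_oppK.
- right; split=> [x y xy|w]; first by rewrite ltrN2 Glt.
  by rewrite Gp opprD.
Qed.

End circle.

(** * Unstable rays *)

Lemma within_continuous_comp (T U V : topologicalType) (A : set U) (c : T -> U)
    (h : U -> V) :
  continuous c -> (forall t, A (c t)) -> {within A, continuous h} ->
  continuous (h \o c).
Proof.
move=> cc cA /subspace_continuousP hA t.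
apply: (@cvg_comp _ _ _ c h _ (within A (nbhs (c t)))); last exact: hA.
move=> B; rewrite /within /= => nB.
have sub : c @^-1` [set x | A x -> B x] `<=` c @^-1` B.
  by move=> s /=; exact.
exact: (filterS sub (cc t _ nB)).
Qed.

(** If [c s] were off [C], its complement would be a neighbourhood of [C]. Yet the points
    [c (s / l ^ i)] tend to [c 0] in [C], and their [i]-th iterates all equal [c s]. *)
Lemma stable_sub_ray (R : realType) (T : topologicalType) (f : T -> T)
    (C : set T) (c : R -> T) (l s0 : R) :
  accessible_space T -> lyapunov_stable f C -> {for 0, continuous c} ->
  C (c 0) -> 1 < l -> (forall s, 0 <= s <= s0 -> f (c s) = c (l * s)) ->
  forall s, 0 <= s <= s0 -> C (c s).
Proof.
move=> T1 fC c0 Cc0 l1 fc s /andP[s_ge0 s_le]; apply: contrapT => Cs.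
have l0 : 0 < l by rewrite (lt_trans ltr01).
have [|V nV VU] := fC (~` [set c s]).
  apply/set_nbhsP; exists (~` [set c s]); split => //.
    by apply: closed_openC; exact: accessible_closed_set1.
  by move=> x Cx /= xc; apply: Cs; rewrite -xc.
have {}nV : nbhs (c 0) V.
  move/set_nbhsP: nV => [B [oB CB BV]]; rewrite nbhsE; exists B => //.
  by split=> //; exact: CB.
have iterE i : iter i f (c (s * l^-1 ^+ i)) = c s.
  elim: i => [|i IH]; first by rewrite expr0 mulr1.
  rewrite iterSr fc.
    by rewrite exprS mulrCA mulVKf // gt_eqF.
  have li : 0 <= l^-1 ^+ i.+1 <= 1.
    by rewrite exprn_ge0 ?exprn_ile1 ?invr_ge0 ?invf_le1 ?(ltW l0) ?(ltW l1).
  move/andP: li => [li0 li1]; rewrite mulr_ge0 //=.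
  by rewrite (le_trans _ s_le) // ler_piMr.
have sl : s * l^-1 ^+ i @[i --> \oo] --> (0 : R).
  rewrite -(mulr0 s); apply: cvgMl_tmp; apply: cvg_expr.
  by rewrite ger0_norm ?invr_ge0 ?(ltW l0) // invf_lt1.
have /(_ _ (c0 _ nV))[N _ NV] := sl.
have := VU _ (NV N (leqnn N)) N.
by rewrite /= iterE.
Qed.

(** In an angular coordinate [tau] around the fixed point [c 0], the ray stays on one side of
    [w = tau 0], and [f] maps it along itself. A decreasing lift would exchange the sides. *)
Lemma decr_lift_no_ray (R : realType) (T : topologicalType) (C : set T)
    (phi : T -> circle R) (psi : circle R -> T) (f : T -> T) (G : R -> R)
    (c : R -> T) (l s0 : R) :
  homeo_with C setT phi psi -> is_lift (phi \o f \o psi) G ->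
  {homo G : x y /~ x < y} -> continuous c -> injective c ->
  0 < s0 -> 1 < l -> (forall s, 0 <= s <= s0 -> C (c s)) ->
  (forall s, 0 <= s <= s0 -> f (c s) = c (l * s)) -> False.
Proof.
move=> [_ _ phic _ [psiK _]] [Gc Gg] Gdec cc ci s0_gt0 l1 Cc fc.
have l0 : 0 < l by rewrite (lt_trans ltr01).
(* Clamping makes the ray a total curve, so that its lift [tau] is continuous
   in the topology of [R] rather than of a subspace. *)
pose clamp (s : R) := Num.max 0 (Num.min s s0).
have clamp_itv s : 0 <= clamp s <= s0.
  by rewrite /clamp le_max lexx ge_max ge_min lexx orbT (ltW s0_gt0).
have clampE s : 0 <= s <= s0 -> clamp s = s.
  by move=> /andP[s1 s2]; rewrite /clamp min_l // max_r.
have clampc : continuous clamp.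
  move=> s; apply: (@continuous_max _ _ (fun=> 0) (fun s => Num.min s s0)).
    exact: cst_continuous.
  by apply: (@continuous_min _ _ id (fun=> s0));
    [exact: cvg_id|exact: cst_continuous].
pose sigma s := phi (c (clamp s)).
have sigmac : continuous sigma.
  apply: (@within_continuous_comp _ _ _ C (c \o clamp) phi) => //.
    by move=> s; apply: continuous_comp; [exact: clampc|exact: cc].
  by move=> s /=; exact: Cc.
pose w := circle_sec 0 (sigma 0).
(* The cut lies at distance 1/2 from [w], so [tau] is continuous while it stays closer than that. *)
pose a := w - 2^-1.
pose tau s := circle_sec a (sigma s).
have tau0 : tau 0 = w.
  rewrite /tau -[sigma 0](circle_secK 0) circle_piK // -/w /a.
  by apply/andP; split; lra.
have tauc s : tau s != a -> {for s, continuous tau}.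
  move=> sa; apply: (@continuous_comp _ _ _ sigma (circle_sec a)).
    exact: sigmac.
  exact: continuous_circle_sec.
have tauc0 : {for 0, continuous tau}.
  by apply: tauc; rewrite tau0 /a; apply/eqP; lra.
have tau_neq s : 0 < s <= s0 -> tau s != w.
  move=> /andP[s_gt0 s_le]; rewrite -tau0; apply/eqP => /circle_sec_inj.
  rewrite /sigma !clampE ?lexx ?(ltW s_gt0) ?(ltW s0_gt0) //.
  have C0 : C (c 0) by apply: Cc; rewrite lexx ltW.
  have Cs : C (c s) by apply: Cc; rewrite s_le ltW.
  move=> /(congr1 psi); rewrite !psiK //.
  by move=> /ci s_eq0; rewrite s_eq0 ltxx in s_gt0.
have near_w : \forall s \near (0 : R), `|w - tau s| < 2^-1.
  by move/cvgrPdist_lt : tauc0; rewrite tau0; apply; rewrite invr_gt0.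
have near_G : \forall s \near (0 : R), `|G w - G (tau s)| < 2^-1.
  have /cvgrPdist_lt : {for 0, continuous (G \o tau)}.
    by apply: continuous_comp; [exact: tauc0|exact: Gc].
  by rewrite /= tau0; apply; rewrite invr_gt0.
have /nbhs_ballP[e /= e0 eP] : \forall s \near (0 : R),
    `|w - tau s| < 2^-1 /\ `|G w - G (tau s)| < 2^-1 by exact: filterI.
pose t := Num.min (e / 2) s0.
have t0 : 0 < t by rewrite lt_min s0_gt0 divr_gt0.
have ts0 : t <= s0 by rewrite ge_min lexx orbT.
have te : t < e by rewrite gt_min; apply/orP; left; lra.
have tP (r : R) : 0 <= r <= t ->
    `|w - tau r| < 2^-1 /\ `|G w - G (tau r)| < 2^-1.
  move=> /andP[s1 s2]; apply: eP; rewrite /ball /= sub0r normrN ger0_norm //.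
  exact: le_lt_trans te.
(* Chosen so that [f] sends [c s] to [c t], with both parameters in the controlled range. *)
pose s := t / l.
have s_gt0 : 0 < s by rewrite divr_gt0.
have lst : l * s = t by rewrite /s mulrCA mulfV ?mulr1 // gt_eqF.
have st : s <= t by rewrite ler_pdivrMr // ler_peMr // ltW.
have Gtau r : 0 <= r -> l * r <= t ->
    exists k : int, G (tau r) = tau (l * r) + k%:~R.
  move=> r0 rt; have lr0 : 0 <= l * r by rewrite mulr_ge0 // ltW.
  have rlr : r <= l * r by rewrite ler_peMl // ltW.
  have rs0 : 0 <= r <= s0 by rewrite r0 (le_trans rlr) // (le_trans rt).
  have lrs0 : 0 <= l * r <= s0 by rewrite lr0 (le_trans rt).
  have Ccr := Cc _ rs0.
  apply: circle_pi_eqP; rewrite Gg !circle_secK /= /sigma !clampE //.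
  by rewrite psiK // fc.
have [k Gk] : exists k : int, G w = w + k%:~R.
  by have := Gtau 0 (lexx _); rewrite mulr0 tau0; apply; exact: ltW.
have [m Gm] : exists m : int, G (tau s) = tau t + m%:~R.
  by have := Gtau s (ltW s_gt0); rewrite lst; apply.
have [] := tP s; first by rewrite (ltW s_gt0).
rewrite Gk Gm => _ h1.
have [h2 _] : `|w - tau t| < 2^-1 /\ `|G w - G (tau t)| < 2^-1.
  by apply: tP; rewrite (ltW t0) lexx.
(* [w + k] is within 1/2 of [tau t + m], and [w] within 1/2 of [tau t], so the integers differ by
   less than 1. *)
have km : k = m.
  move: h1 h2; rewrite !ltr_norml => /andP[h1 h2] /andP[h3 h4].
  have h5 : (k%:~R : R) < (m + 1)%:~R by rewrite intrD mulr1z; lra.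
  have h6 : (m%:~R : R) < (k + 1)%:~R by rewrite intrD mulr1z; lra.
  by move: h5 h6; rewrite !ltr_int; lia.
(* As [G (tau s) - G w = tau t - w], a decreasing [G] puts [tau s] and [tau t]
   on opposite sides of [w]; but [tau] avoids [w] off 0. *)
have wt : Num.min (tau s) (tau t) <= w <= Num.max (tau s) (tau t).
  have : tau s != w by apply: tau_neq; rewrite s_gt0 (le_trans st).
  rewrite neq_lt => /orP[] /[dup] h /Gdec.
    rewrite Gk Gm km ltrD2r => h'.
    by rewrite ge_min le_max (ltW h) (ltW h') orbT.
  rewrite Gk Gm km ltrD2r => h'.
  by rewrite ge_min le_max (ltW h) (ltW h') orbT.
have tau_in : {within `[s, t], continuous tau}.
  apply: continuous_in_subspaceT => r; rewrite inE /= in_itv /= => /andP[sr rt].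
  have /tP[h _] : 0 <= r <= t by rewrite rt (le_trans (ltW s_gt0)).
  apply: tauc; rewrite /a; apply/eqP => e1; move: h; rewrite e1.
  by rewrite opprD addrA subrr add0r opprK ger0_norm ?ltxx // invr_ge0.
have [r + rw] := IVT st tau_in wt.
rewrite in_itv /= => /andP[sr rt].
have /eqP[] : tau r != w.
  by apply: tau_neq; rewrite (lt_le_trans s_gt0) //= (le_trans rt).
exact: rw.
Qed.

(** * Fixed points of decreasing lifts and the degree *)

Lemma decr_translation_value (R : realType) (G : R -> R) (j : R) :
  continuous G -> {homo G : x y /~ x < y} -> exists w, G w = w + j.
Proof.
(* With this [M], [G 0] lies between [- M + j] and [M + j]; monotonicity then makes [G w - w] at
   least [j] at [- M] and at most [j] at [M]. *)
move=> Gc Gdec; pose M := `|G 0 - j|.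
have Gle x y : x <= y -> G y <= G x.
  by rewrite le_eqVlt => /orP[/eqP ->//|/Gdec/ltW].
have M0 : 0 <= M by exact: normr_ge0.
have h1 : G M <= M + j.
  by rewrite (le_trans (Gle _ _ M0)) // -lerBlDr ler_norm.
have h2 : - M + j <= G (- M).
  rewrite (le_trans _ (Gle (- M) 0 _)) ?oppr_le0 // -lerBrDr.
  by rewrite lerNl (le_trans (ler_norm _)) // normrN.
have Kc : {within `[- M, M], continuous (fun w => G w - w)}.
  apply: continuous_subspaceT => w.
  by apply: cvgB; [exact: Gc|exact: cvg_id].
have [||w _ wE] := @IVT _ _ (- M) M j _ Kc; first by lra.
  rewrite ge_min le_max; apply/andP; split; apply/orP; [right|left]; lra.
by exists w; rewrite -wE addrC subrK.
Qed.

Lemma homeo_conj_bij (R : realType) (T : topologicalType) (C : set T)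
    (phi : T -> circle R) (psi : circle R -> T) (f : T -> T) :
  homeo_with C setT phi psi -> continuous f -> injective f -> f @` C = C ->
  let g := phi \o f \o psi in
  [/\ continuous g, injective g & forall q, exists p, g p = q].
Proof.
move=> [phiC psiC phic psic [psiK phiK]] fc fi fC g.
have Cf x : C x -> C (f x) by move=> Cx; rewrite -fC; exists x.
have psiC' p : C (psi p) by exact: psiC.
split.
- apply: (@within_continuous_comp _ _ _ C (f \o psi) phi) => //; last first.
    by move=> p; apply: Cf.
  move=> p; apply: continuous_comp; last exact: fc.
  have psic' : continuous psi by apply/continuous_subspace_setT.
  exact: psic'.
- move=> p q /(congr1 psi); rewrite /g /= !psiK; try exact: Cf.
  by move=> /fi/(congr1 phi); rewrite !phiK.
- move=> q; have : C (psi q) by [].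
  rewrite -{1}fC => -[x Cx fx]; exists (phi x).
  by rewrite /g /= psiK // fx phiK.
Qed.

Theorem theorem4p2 (R : realType) (n : nat) (AL AR : 'M[R]_n.+1)
    (b : 'cV[R]_n.+1)
    (Acol : forall j : 'I_n.+1, j != ord0 -> col j AL = col j AR)
    (detA : 0 < \det AL * \det AR)
    (detIL : \det (1%:M - AL) != 0)
    (detIR : \det (1%:M - AR) != 0)
    (rho_b : row ord0 (\adj (1%:M - AL)) *m b != 0)
    (C : set 'cV[R]_n.+1)
    (circC : invariant_circle (pwl_map AL AR b) C)
    (stableC : lyapunov_stable (pwl_map AL AR b) C) :
  homeo_on C C (pwl_map AL AR b) /\ has_degree_on R C (pwl_map AL AR b) 1.
Proof.
set f := pwl_map AL AR b; case: circC => _ fC.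
have fK : cancel f (pwl_inv AL AR b) by exact: pwl_mapK.
have fc : continuous f by exact: continuous_pwl_map.
split.
  exists (pwl_inv AL AR b); split.
  - by move=> x Cx; rewrite -fC; exists x.
  - by move=> y; rewrite -{1}fC => -[x Cx <-]; rewrite fK.
  - exact: continuous_subspaceT.
  - by apply: continuous_subspaceT; exact: continuous_pwl_inv.
  - split=> [x _|y]; first exact: fK.
    by rewrite -{1}fC => -[x Cx <-]; rewrite fK.
move=> phi psi hw.
have [gc gi gs] := homeo_conj_bij hw fc (can_inj fK) fC.
have [G [Gc Gg [[_ G1]|[Gdec G1]]]] := circle_lift gc gi gs.
  by exists G => //; have := G1 0; rewrite add0r => ->; rewrite addrC addKr.
(* Solutions of [G w = w] and [G w = w + 1] both project to fixed points of the circle map. *)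
exfalso; have [w0 Gw0] := decr_translation_value 0 Gc Gdec.
have [w1 Gw1] := decr_translation_value 1 Gc Gdec.
have [phiC psiC phic psic [psiK phiK]] := hw.
have fpsi w (k : int) : G w = w + k%:~R ->
    f (psi (circle_pi w)) = psi (circle_pi w).
  move=> Gw; have := Gg w; rewrite Gw circle_piDz => /(congr1 psi).
  have Cpsi : C (psi (circle_pi w)) by exact: psiC.
  have Cf : C (f (psi (circle_pi w))).
    by rewrite -fC; exists (psi (circle_pi w)).
  by rewrite /= psiK // => <-.
have fx := fpsi w0 0 Gw0; have fy := fpsi w1 1 Gw1.
have xy : psi (circle_pi w0) != psi (circle_pi w1).
  (* In degree -1, [G w - w] drops by 2 over a unit step. Its values 0 at [w0] and 1 at [w1] thus
     force [0 < w0 - w1 < 1], so the difference is no integer. *)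
  apply/eqP => /(congr1 phi); rewrite !phiK // => /circle_pi_eqP[k w01].
  have Gle x y : x <= y -> G y <= G x.
    by rewrite le_eqVlt => /orP[/eqP ->//|/Gdec/ltW].
  have k0 : ((0 : int)%:~R : R) < k%:~R.
    rewrite ltNge; apply/negP => k0; rewrite mulr0z in k0.
    have : w0 <= w1 by lra.
    by move=> /Gle; rewrite Gw0 Gw1; lra.
  have k1 : (k%:~R : R) < (1 : int)%:~R.
    rewrite ltNge; apply/negP => k1; rewrite mulr1z in k1.
    have : w1 + 1 <= w0 by lra.
    by move=> /Gle; rewrite G1 Gw0 Gw1; lra.
  by move: k0 k1; rewrite !ltr_int; lia.
have [z zxy [v [l [s0 [v0 l1 s0_gt0 fray]]]]] :=
  pwl_map_saddle Acol detIL detIR rho_b xy fx fy.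
have Cz : C z by case: zxy => ->; exact: psiC.
pose c (s : R) := z + s *: v.
have cc : continuous c.
  move=> s; apply: cvgD; first exact: cst_continuous.
  by apply: cvgZr_tmp; exact: cvg_id.
have ci : injective c.
  move=> s t /addrI/eqP; rewrite -subr_eq0 -scalerBl scaler_eq0 subr_eq0.
  by rewrite (negPf v0) orbF => /eqP.
apply: (decr_lift_no_ray hw (conj Gc Gg) Gdec cc ci s0_gt0 l1 _ fray).
apply: (stable_sub_ray _ stableC (cc 0) _ l1 fray).
  by apply: hausdorff_accessible; exact: norm_hausdorff.
by rewrite /c scale0r addr0.
Qed.
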